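(* Let $\mathcal{X}$ be a Polish space, $\mu_0\in\mathcal{P}(\mathcal{X})$, let $\mathcal{H}\subseteq C_b(\mathcal{X})$ be a linear space containing the constant functions, and assume that the superhedging functional $\phi(f)=\inf\{\int h\,d\mu_0 : h\in\mathcal{H},\ h\ge f\}$, $f\in C_b(\mathcal{X})$, is continuous from above. Let $\mathcal{Q}=\{\mu\in\mathcal{P}(\mathcal{X}):\int h\,d\mu=\int h\,d\mu_0\text{ for all }h\in\mathcal{H}\}$. Let $\theta\in\mathcal{P}(\mathcal{X})$, $\gamma>0$, let $\beta\colon\mathbb{R}\to\mathbb{R}_+$ be a differentiable nondecreasing convex function with $\lim_{x\to\infty}\beta(x)/x=\infty$, and put $\beta_\gamma(x)=\frac1\gamma\beta(\gamma x)$ and $$\phi_{\theta,\gamma}(f)=\inf_{h\in\mathcal{H}}\Big\{\int h\,d\mu_0+\int\beta_\gamma(f-h)\,d\theta\Big\}.$$ Let $f\in C_b(\mathcal{X})$. Suppose there exists $\pi\in\mathcal{Q}$ such that $\pi\ll\theta$ and $\int\beta^\ast\big(\frac{d\pi}{d\theta}\big)\,d\theta<\infty$. Then: (i) $$\phi_{\theta,\gamma}(f)=\max_{\mu\in\mathcal{Q}}\Big\{\int f\,d\mu-\frac1\gamma\int\beta^\ast\Big(\frac{d\mu}{d\theta}\Big)\,d\theta\Big\}$$ (in particular the maximum is attained). (ii) $$\phi_{\theta,\gamma}(f)-\frac{\beta(0)}{\gamma}\le\phi(f)\le\phi_{\theta,\gamma}(f)+\frac1\gamma\int\beta^\ast\Big(\frac{d\mu_\varepsilon}{d\theta}\Big)\,d\theta+\varepsilon$$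 whenever $\mu_\varepsilon\in\mathcal{Q}$ is an $\varepsilon$-optimizer of the problem $\phi(f)=\max_{\mu\in\mathcal{Q}}\int f\,d\mu$ such that $\mu_\varepsilon\ll\theta$ and $\int\beta_\gamma^\ast\big(\frac{d\mu_\varepsilon}{d\theta}\big)\,d\theta<\infty$. (iii) If $\hat h\in\mathcal{H}$ is a minimizer in the definition of $\phi_{\theta,\gamma}(f)$, then $\hat\mu\in\mathcal{P}(\mathcal{X})$ defined by $\frac{d\hat\mu}{d\theta}:=\beta_\gamma'(f-\hat h)$ is a maximizer of the right-hand side in (i).
   Context: $\mathcal{P}(\mathcal{X})$ is the set of Borel probability measures on $\mathcal{X}$; $C_b(\mathcal{X})$ is the space of continuous bounded functions $\mathcal{X}\to\mathbb{R}$; inequalities between functions are pointwise. Continuity from above of $\phi$ means: $\phi(f_n)\downarrow 0$ for every sequence $(f_n)$ in $C_b(\mathcal{X})$ with $f_n\downarrow 0$ pointwise. Under this assumption $\phi(f)=\max_{\mu\in\mathcal{Q}}\int f\,d\mu$ for all $f\in C_b(\mathcal{X})$. An $\varepsilon$-optimizer of this maximization problem is a measure $\mu_\varepsilon\in\mathcal{Q}$ with $\int f\,d\mu_\varepsilon\ge\phi(f)-\varepsilon$. The convex conjugates are $\beta^\ast(y)=\sup_{x\in\mathbb{R}}\{xy-\beta(x)\}$ and $\beta_\gamma^\ast(y)=\sup_{x\in\mathbb{R}}\{xy-\beta_\gamma(x)\}=\beta^\ast(y)/\gamma$ for $y\in\mathbb{R}_+$. Convention: $\int\beta^\ast\big(\frac{d\mu}{d\theta}\big)\,d\theta:=+\infty$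 if $\mu$ is not absolutely continuous with respect to $\theta$. *)

(* Defs.v *)
From HB Require Import structures.
From mathcomp Require Import all_boot all_order all_algebra.
From mathcomp Require Import all_classical all_reals all_analysis.

Set Implicit Arguments.
Unset Strict Implicit.
Unset Printing Implicit Defensive.

Import Order.TTheory GRing.Theory Num.Theory.
Import numFieldNormedType.Exports.

Local Open Scope classical_set_scope.
Local Open Scope ring_scope.
Local Open Scope charge_scope.
Local Open Scope ereal_scope.

(* Separable and homeomorphic to a complete metric space; the metric on X
   itself is not part of the data. *)
Definition polish (R : realType) (X : topologicalType) : Prop :=
  (exists2 D : set X, countable D & dense D) /\
  exists (M : metricType R) (to : X -> M) (from : M -> X),
    [/\ cancel to from, cancel from to, continuous to, continuous from
      & forall F : set_system M, ProperFilter F -> cauchy F -> exists y : M, F --> y].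

Definition borel (X : ptopologicalType) := g_sigma_algebraType (@open X).

Definition decreases_to (R : realType) (u : nat -> \bar R) (l : \bar R) : Prop :=
  nonincreasing_seq u /\ u @ \oo --> l.

(* v is the maximum of F over A; in particular it is attained. *)
Definition is_max (R : realType) (T : Type) (A : set T) (F : T -> \bar R)
    (v : \bar R) : Prop :=
  (exists2 t, A t & F t = v) /\ forall t, A t -> F t <= v.

Definition is_maximizer (R : realType) (T : Type) (A : set T)
    (F : T -> \bar R) (t : T) : Prop :=
  A t /\ forall s, A s -> F s <= F t.

Definition is_minimizer (R : realType) (T : Type) (A : set T)
    (F : T -> \bar R) (t : T) : Prop :=
  A t /\ forall s, A s -> F t <= F s.

Definition conjugate (R : realType) (b : R -> R) (y : R) : \bar R :=
  ereal_sup [set (x * y - b x)%:E | x in [set: R]].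

Definition beta_scaled (R : realType) (beta : R -> R) (gamma : R) (x : R) : R :=
  (gamma^-1 * beta (gamma * x))%R.

Section superhedging.
Context (R : realType) (X : ptopologicalType).
Implicit Types (f h : X -> R) (mu theta : probability (borel X) R).

Definition Cb : set (X -> R) := [set f | continuous f /\ bounded_fun f].

Definition linear_space (H : set (X -> R)) : Prop :=
  H (fun=> 0%R) /\
  forall (a : R) h1 h2, H h1 -> H h2 -> H (fun x => (a * h1 x + h2 x)%R).

Definition superhedging mu0 (H : set (X -> R)) f : \bar R :=
  ereal_inf [set \int[mu0]_x (h x)%:E | h in
             [set h | H h /\ forall x, (f x <= h x)%R]].

Definition continuous_from_above (phi : (X -> R) -> \bar R) : Prop :=
  forall fn : nat -> X -> R, (forall n, Cb (fn n)) ->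
    (forall x, decreases_to (fun n => (fn n x)%:E) 0) ->
    decreases_to (fun n => phi (fn n)) 0.

(* The set Q of probability measures that agree with mu0 on H. *)
Definition marginal_class mu0 (H : set (X -> R)) :
    set (probability (borel X) R) :=
  [set mu : probability (borel X) R | forall h, H h ->
     \int[mu]_x (h x)%:E = \int[mu0]_x (h x)%:E].

Definition penalized_cost mu0 theta (b : R -> R) f h : \bar R :=
  \int[mu0]_x (h x)%:E + \int[theta]_x (b (f x - h x)%R)%:E.

Definition penalized_superhedging mu0 (H : set (X -> R)) theta (b : R -> R) f :
    \bar R :=
  ereal_inf [set penalized_cost mu0 theta b f h | h in H].

(* The library's Radon-Nikodym derivative is finite everywhere but nonnegative
   only theta-almost everywhere, so [fine] loses nothing and c need only be
   meaningful on nonnegative reals. *)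
Definition divergence (c : R -> \bar R) theta mu : \bar R :=
  if `[< mu `<< theta >]
  then \int[theta]_x c (fine ('d (charge_of_finite_measure mu) '/d theta x))
  else +oo.

Definition dual_objective theta (beta : R -> R) (gamma : R) f mu : \bar R :=
  \int[mu]_x (f x)%:E - gamma^-1%:E * divergence (conjugate beta) theta mu.

Definition eps_optimizer mu0 (H : set (X -> R)) f (eps : R) mu : Prop :=
  marginal_class mu0 H mu /\
  superhedging mu0 H f - eps%:E <= \int[mu]_x (f x)%:E.

End superhedging.

(* Main.v *)
Require Import Defs.
From HB Require Import structures.
From mathcomp Require Import all_boot all_order all_algebra.
From mathcomp Require Import all_classical all_reals all_analysis.
From mathcomp Require Import measurable_realfun ring lra.
Import Order.TTheory GRing.Theory Num.Theory.
Import numFieldNormedType.Exports.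
Local Open Scope classical_set_scope.
Local Open Scope ring_scope.

(* Strong duality by a subgradient. Write psi(g) for the penalized functional
   at a bounded measurable function g; it is convex and, because of pi,
   finite. A convex Hahn-Banach theorem applied at f, on the space of all
   bounded measurable functions rather than on C_b(X), yields a linear L with
   L g <= psi(f + g) - psi(f). Testing the infimum defining psi(f + g) with an
   e-optimal h for f gives
     L g <= e + \int (beta_gamma(f + g - h) - beta_gamma(f - h)) dtheta,
   so by bounded convergence L is integration against a probability measure mu
   dominated by theta; since H is linear, L agrees with mu0 on H, so mu is in
   the class Q. Testing with h = 0 bounds \int (v dmu/dtheta - beta(v)) dtheta
   by gamma (\int f dmu - psi(f)) for every bounded measurable v, and the
   supremum over v is the divergence. The other inequality is Young's, and a
   minimizer turns into a density through its first-order condition. *)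

(** * Convex Hahn-Banach theorem *)

Section convex_hahn_banach.
Context (R : realType) (V : lmodType R) (D : set V) (p : V -> R).
Hypothesis D0 : D 0.
Hypothesis D_lin : forall a u v, D u -> D v -> D (a *: u + v).
Hypothesis p_convex : forall t u v, 0 <= t <= 1 -> D u -> D v ->
  p (t *: u + (1 - t) *: v) <= t * p u + (1 - t) * p v.

(** Partial linear functionals below [p], encoded as graphs. The empty graph qualifies, which covers
    the empty chain in Zorn's lemma; single-valuedness is not imposed, since it follows from the
    bound by [p]. *)
Let admissible (G : set (V * R^o)) :=
  (forall a x y, G x -> G y -> G (a *: x + y)) /\
  (forall x, G x -> D x.1 /\ x.2 <= p x.1).

(** One-step extension in the direction [v]. A value [c] exists because every slope taken towards
    [- v] is at most every slope taken towards [v], and convexity is enough for this comparison. *)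
Lemma hahn_banach_bound (G : set (V * R^o)) v : admissible G -> D v -> G !=set0 ->
  exists c : R, forall a x, G x -> x.2 + a * c <= p (x.1 + a *: v).
Proof.
move=> [Glin Gp] Dv [g0 Gg0].
have Gsum s t x y : G x -> G y -> G (s *: x + t *: y).
  move=> Gx Gy; apply: (Glin) => //.
  have -> : t *: y = (t - 1) *: y + y by rewrite scalerBl scale1r subrK.
  exact: Glin.
have Dsum w a : D w -> D (w + a *: v) by move=> Dw; rewrite addrC; exact: D_lin.
have cross x y t s : G x -> G y -> 0 < t -> 0 < s ->
    (x.2 - p (x.1 - t *: v)) / t <= (p (y.1 + s *: v) - y.2) / s.
  move=> Gx Gy t0 s0; rewrite ler_pdivrMr// mulrAC ler_pdivlMr//.
  have st0 : 0 < s + t by rewrite addr_gt0.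
  (* The weights [s / (s + t)] and [t / (s + t)] make the two displacements along [v] cancel. *)
  have [_] := Gp _ (Gsum (s / (s + t)) (t / (s + t)) _ _ Gx Gy).
  have -> : (s / (s + t) *: x + t / (s + t) *: y).1 =
      s / (s + t) *: (x.1 + (- t) *: v) + (1 - s / (s + t)) *: (y.1 + s *: v).
    have -> : 1 - s / (s + t) = t / (s + t) by field; rewrite gt_eqF.
    rewrite /= !scalerDr !scalerA addrACA -scalerDl.
    have -> : s / (s + t) * - t + t / (s + t) * s = 0 by ring.
    by rewrite scale0r addr0.
  have st1 : 0 <= s / (s + t) <= 1.
    by rewrite divr_ge0 ?(ltW s0) ?(ltW st0)//= ler_pdivrMr// mul1r lerDl ltW.
  have [Dx _] := Gp _ Gx; have [Dy _] := Gp _ Gy.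
  move=> /le_trans /(_ (p_convex _ _ _ st1 (Dsum _ _ Dx) (Dsum _ _ Dy))).
  have -> : 1 - s / (s + t) = t / (s + t) by field; rewrite gt_eqF.
  rewrite scaleNr -(ler_pM2l st0) /=.
  have E1 A B : (s + t) * (s / (s + t) * A + t / (s + t) * B) = s * A + t * B.
    by field; rewrite gt_eqF.
  rewrite -[X in _ * X <= _ -> _]/(s / (s + t) * x.2 + t / (s + t) * y.2) !E1; lra.
pose S := [set r : R | exists x t, [/\ G x, 0 < t & r = (x.2 - p (x.1 - t *: v)) / t]].
have ubS y s : G y -> 0 < s -> ubound S ((p (y.1 + s *: v) - y.2) / s).
  by move=> Gy s0 _ [x [t [Gx t0 ->]]]; exact: cross.
have supS : has_sup S.
  split; first by exists ((g0.2 - p (g0.1 - 1 *: v)) / 1), g0, 1.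
  by exists ((p (g0.1 + 1 *: v) - g0.2) / 1); exact: ubS.
exists (sup S) => a x Gx; have [a0|a0|->] := ltgtP a 0.
- have : S ((x.2 - p (x.1 - (- a) *: v)) / - a) by exists x, (- a); rewrite oppr_gt0.
  move=> /(sup_upper_bound supS); rewrite ler_pdivrMr ?oppr_gt0//.
  rewrite scaleNr opprK; lra.
- have /(ge_sup supS.1) := ubS _ _ Gx a0.
  by rewrite ler_pdivlMr//; lra.
- by rewrite mul0r scale0r !addr0; have [] := Gp _ Gx.
Qed.

(** Zorn's lemma gives a maximal graph, and the one-step extension shows that it covers [D]. *)
Theorem convex_hahn_banach : 0 <= p 0 -> exists L : V -> R,
  (forall a u v, D u -> D v -> L (a *: u + v) = a * L u + L v) /\
  (forall v, D v -> L v <= p v).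
Proof.
move=> p0.
have [C CG totC|G [[Glin Gp] Gmax]] := @Zorn_bigcup _ admissible.
  split => [a x y [A CA Ax] [B CB By]|x [A /CG[_ +] Ax]]; last exact.
  by have [AB|BA] := totC _ _ CA CB; [exists B|exists A] => //;
    apply: (CG _ _).1 => //; [exact: AB|exact: BA].
have {}Gmax B : admissible B -> G `<=` B -> B = G.
  by move=> aB GB; apply: contrapT => BG; apply: (Gmax B) => //; split => // /(conj GB)/seteqP/esym.
(* The graph reduced to the origin is admissible because [0 <= p 0], so a maximal graph is not
   empty. *)
have G0 : G !=set0.
  apply/set0P/eqP => G0; suff : [set 0] = G by rewrite G0; apply/eqP/set0P; exists 0.
  apply: Gmax; last by rewrite G0.
  by split => [a x y -> ->|x ->]; [rewrite /= scaler0 addr0|split].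
have GZ a x : G x -> G (a *: x).
  move=> Gx; have -> : a *: x = (a - 1) *: x + x by rewrite scalerBl scale1r subrK.
  exact: Glin.
(* All multiples of a point above 0 would stay below [p 0], but for [r != 0] one of them has the
   value [p 0 + 1]. *)
have Gfun0 r : G (0, r) -> r = 0.
  move=> Gr; have kr k : k * r <= p 0 by have [_ /=] := Gp _ (GZ k _ Gr); rewrite scaler0.
  apply: contrapT => /eqP r0.
  by have := kr ((p 0 + 1) / r); rewrite divfK//; lra.
have Gfun v r s : G (v, r) -> G (v, s) -> r = s.
  move=> Gr Gs; apply/eqP; rewrite eq_sym -subr_eq0 addrC; apply/eqP/Gfun0.
  have := Glin (-1) _ _ Gr Gs.
  by rewrite -[X in G X]/(_ *: v + v, -1 * r + s) scaleN1r addNr mulN1r.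
have Gtot v : D v -> exists r, G (v, r).
  move=> Dv; have [c Gc] := @hahn_banach_bound G v (conj Glin Gp) Dv G0.
  pose G' : set (V * R^o) := [set z | exists a x, G x /\ z = x + a *: (v, c)].
  have GG' : G `<=` G' by move=> x Gx; exists 0, x; rewrite scale0r addr0.
  have {}/Gmax : admissible G'.
    split=> [b x y [a [x' [Gx ->]]] [a' [y' [Gy ->]]]|x [a [x' [Gx ->]]]].
      exists (b * a + a'), (b *: x' + y'); split; first exact: Glin.
      by rewrite scalerDr addrACA scalerA -scalerDl.
    split; last exact: Gc.
    by rewrite /= addrC; apply: D_lin => //; have [] := Gp _ Gx.
  move=> /(_ GG') G'G; have [g Gg] := G0; exists c; rewrite -G'G.
  by exists 1, (0 *: g); split; [exact: GZ|rewrite scale0r scale1r add0r].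
(* Off [D] the functional gets the default value 0. *)
exists (fun v => if pselect (D v) is left Dv then projT1 (cid (Gtot v Dv)) else 0).
have G_val v (Dv : D v) : G (v, projT1 (cid (Gtot v Dv))) by case: cid.
split=> [a u v Du Dv|v Dv]; last by case: pselect => // Dv'; have [] := Gp _ (G_val _ Dv').
case: pselect => [Duv|/(_ (D_lin _ _ _ Du Dv))//].
case: pselect => // Du'; case: pselect => // Dv'.
by apply: (Gfun (a *: u + v)) (G_val _ _) _; exact: Glin a _ _ (G_val _ Du') (G_val _ Dv').
Qed.

End convex_hahn_banach.

(** * Bounded measurable functions *)

Section bounded_measurable.
Local Set Implicit Arguments.
Local Unset Strict Implicit.
Context {d : measure_display} {T : measurableType d} {R : realType}.
Implicit Types (f g : T -> R) (mu : probability T R).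

Definition bounded_measurable : set (T -> R) :=
  [set f | measurable_fun [set: T] (f : T -> R) /\ exists K : R, forall x, `|f x| <= K].
Local Notation bm := bounded_measurable.

Lemma bm_cst (c : R) : bm (fun=> c).
Proof. by split=> //; exists `|c|. Qed.

Lemma bm_lin (a : R) f g : bm f -> bm g -> bm (fun x => a * f x + g x).
Proof.
move=> [mf [K fK]] [mg [L gL]]; split.
  by apply: measurable_funD => //; apply: measurable_funM.
exists (`|a| * K + L) => x; rewrite (le_trans (ler_normD _ _))// normrM.
by apply: lerD => //; exact: ler_wpM2l.
Qed.

Lemma bmD f g : bm f -> bm g -> bm (fun x => f x + g x).
Proof. by move=> bf bg; have := bm_lin 1 bf bg; under eq_fun do rewrite mul1r. Qed.

Lemma bmZ (a : R) f : bm f -> bm (fun x => a * f x).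
Proof. by move=> bf; have := bm_lin a bf (bm_cst 0); under eq_fun do rewrite addr0. Qed.

Lemma bmB f g : bm f -> bm g -> bm (fun x => f x - g x).
Proof. by move=> bf bg; under eq_fun do rewrite addrC -mulN1r; exact: bm_lin. Qed.

Lemma bmM f g : bm f -> bm g -> bm (fun x => f x * g x).
Proof.
move=> [mf [K fK]] [mg [L gL]]; split; first exact: measurable_funM.
by exists (K * L) => x; rewrite normrM ler_pM.
Qed.

Lemma bm_indic (A : set T) : measurable A -> bm \1_A.
Proof.
move=> mA; split; first exact: measurable_indic.
by exists 1 => x; rewrite indicE; case: (_ \in _); rewrite ?normr1 ?normr0.
Qed.

Lemma bm_sum (I : Type) (s : seq I) (F : I -> T -> R) : (forall i, bm (F i)) ->
  bm (fun x => \sum_(i <- s) F i x).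
Proof.
move=> bF; elim: s => [|i s ih]; first by under eq_fun do rewrite big_nil; exact: bm_cst.
by under eq_fun do rewrite big_cons; exact: bmD.
Qed.

(** Monotonicity alone gives both measurability and a bound, the latter from the values of [b] at
    [K] and [- K]. *)
Lemma bm_comp (b : R -> R) f : 
  {homo b : x y / x <= y} -> bm f -> bm (fun x => b (f x)).
Proof.
move=> b_nd [mf [K fK]]; split.
  by apply: measurableT_comp mf; exact: nondecreasing_measurable.
exists (Num.max `|b K| `|b (- K)|) => x.
have /ler_normlP[fK1 fK2] := fK x.
have bu := b_nd _ _ fK2; have bl : b (- K) <= b (f x) by apply: b_nd; rewrite lerNl.
rewrite le_max; have [b0|b0] := lerP 0 (b (f x)).
  by rewrite (ger0_norm b0) (le_trans bu) ?ler_norm.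
by rewrite (ltr0_norm b0) orbC lerNl (le_trans _ bl)// lerNl -normrN ler_norm.
Qed.

Lemma bm_integrable mu f : bm f -> mu.-integrable setT (EFin \o f).
Proof.
move=> [mf [K fK]]; apply: measurable_bounded_integrable => //.
  exact: fin_num_fun_lty.
by exists K; split; [exact: num_real|move=> M KM x _; exact: le_trans (fK x) (ltW KM)].
Qed.

Lemma EFin_Rintegral mu f : bm f -> (\int[mu]_x (f x)%:E)%E = (\int[mu]_x f x)%:E.
Proof. by move=> bf; rewrite fineK//; apply: integrable_fin_num => //; exact: bm_integrable. Qed.

Lemma RintegralT_lin mu (a : R) f g : bm f -> bm g ->
  \int[mu]_x (a * f x + g x) = a * \int[mu]_x f x + \int[mu]_x g x.
Proof.
move=> bf bg; rewrite RintegralD//; last exact: bm_integrable.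
  by rewrite RintegralZl//; exact: bm_integrable.
exact/bm_integrable/bmZ.
Qed.

Lemma RintegralT_D mu f g : bm f -> bm g ->
  \int[mu]_x (f x + g x) = \int[mu]_x f x + \int[mu]_x g x.
Proof. by move=> bf bg; rewrite RintegralD//; exact: bm_integrable. Qed.

Lemma RintegralT_B mu f g : bm f -> bm g ->
  \int[mu]_x (f x - g x) = \int[mu]_x f x - \int[mu]_x g x.
Proof. by move=> bf bg; rewrite RintegralB//; exact: bm_integrable. Qed.

Lemma RintegralT_Z mu (a : R) f : bm f -> \int[mu]_x (a * f x) = a * \int[mu]_x f x.
Proof. by move=> bf; rewrite RintegralZl//; exact: bm_integrable. Qed.

Lemma RintegralT_le mu f g : bm f -> bm g -> (forall x, f x <= g x) ->
  \int[mu]_x f x <= \int[mu]_x g x.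
Proof. by move=> bf bg fg; apply: le_Rintegral => //; exact: bm_integrable. Qed.

Lemma RintegralT_cst mu (c : R) : \int[mu]_x c = c.
Proof. by rewrite Rintegral_cst// [X in fine X](probability_setT mu) mulr1. Qed.

Lemma RintegralT_indic mu A : measurable A -> \int[mu]_x \1_A x = fine (mu A).
Proof. by move=> mA; rewrite /Rintegral integral_indic// setIT. Qed.

Lemma bounded_convergence mu (F : nat -> T -> R) f (K : R) :
  (forall n, measurable_fun setT (F n)) -> (forall n x, `|F n x| <= K) ->
  (forall x, F n x @[n --> \oo] --> f x) ->
  bm f /\ \int[mu]_x F n x @[n --> \oo] --> \int[mu]_x f x.
Proof.
move=> mF FK Ff.
have bf : bm f.
  split; first exact: (measurable_fun_cvg mF (fun x _ => Ff x)).
  exists K => x; have cn : `|F n x| @[n --> \oo] --> `|f x| by apply: cvg_norm.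
  by rewrite -(cvg_lim _ cn)//; apply: limr_le; [exact: cvgP cn|exact: nearW].
split=> //.
have bF n : bm (F n) by split=> //; exists K.
have := @dominated_cvg _ _ _ mu setT measurableT (fun n x => (F n x)%:E)
  (EFin \o f) (EFin \o cst K).
move=> h; apply: fine_cvg; rewrite -EFin_Rintegral//; apply: h => //.
- by move=> n; apply/measurable_EFinP.
- by move=> x _; apply: cvg_EFin; [exact: nearW|exact: Ff].
- exact: (bm_integrable mu (bm_cst K)).
- by move=> n x _; rewrite /= lee_fin.
Qed.
End bounded_measurable.

(** * Positive functionals as integrals *)

Section probability_of_measure.
Context {d : measure_display} {T : measurableType d} {R : realType}.
Variables (m : {measure set T -> \bar R}) (m1 : m setT = 1%E).

(** An alias of [m] that carries the proof of mass one as an argument, so that a probability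
    structure can be attached to it. *)
Definition probability_of_measure of m setT = 1%E : set T -> \bar R := m.
Local Notation P := (probability_of_measure m1).

HB.instance Definition _ := Measure.on P.
HB.instance Definition _ := Measure_isProbability.Build d T R P m1.

End probability_of_measure.

Section daniell_representation.
Local Set Implicit Arguments.
Local Unset Strict Implicit.
Context {d : measure_display} {T : measurableType d} {R : realType}.
Local Notation bm := (@bounded_measurable d T R).
Variable L : (T -> R) -> R.
Hypothesis L_lin : forall a f g, bm f -> bm g ->
  L (fun x => a * f x + g x) = a * L f + L g.
Hypothesis L_ge0 : forall f, bm f -> (forall x, 0 <= f x) -> 0 <= L f.
Hypothesis L1 : L (fun=> 1) = 1.
Hypothesis L_cvg0 : forall F : nat -> T -> R,
  (forall n, measurable_fun setT (F n)) -> (forall n x, 0 <= F n x <= 1) ->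
  (forall x, F n x @[n --> \oo] --> (0 : R)) -> L (F n) @[n --> \oo] --> (0 : R).

Let L0 : L (fun=> 0) = 0.
Proof.
have := L_lin (-1) (bm_cst 0) (bm_cst 0).
by under eq_fun do rewrite mulr0 addr0; rewrite mulN1r addNr.
Qed.

Let LD f g : bm f -> bm g -> L (fun x => f x + g x) = L f + L g.
Proof.
move=> bf bg; have := L_lin 1 bf bg; rewrite mul1r => <-.
by under [in RHS]eq_fun do rewrite mul1r.
Qed.

Let LZ a f : bm f -> L (fun x => a * f x) = a * L f.
Proof.
move=> bf; have := L_lin a bf (bm_cst 0); rewrite L0 addr0 => <-.
by under [in RHS]eq_fun do rewrite addr0.
Qed.

Let LB f g : bm f -> bm g -> L (fun x => f x - g x) = L f - L g.
Proof.
move=> bf bg; rewrite -mulN1r -LZ// -LD//; last exact: bmZ.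
by under [in RHS]eq_fun do rewrite mulN1r.
Qed.

Let L_sum (I : Type) (s : seq I) (F : I -> T -> R) : (forall i, bm (F i)) ->
  L (fun x => \sum_(i <- s) F i x) = \sum_(i <- s) L (F i).
Proof.
move=> bF; elim: s => [|i s ih].
  by under eq_fun do rewrite big_nil; rewrite big_nil.
by under eq_fun do rewrite big_cons; rewrite big_cons LD ?ih//; exact: bm_sum.
Qed.

(* The maximum only matters for non-measurable sets. *)
Let m (A : set T) : \bar R := (Num.max 0 (L \1_A))%:E.

Let mE A : measurable A -> m A = (L \1_A)%:E.
Proof.
move=> mA; rewrite /m max_r// L_ge0//; first exact: bm_indic.
Qed.

Let m0 : m set0 = 0%E.
Proof. by rewrite mE// indic0 L0. Qed.

Let m_ge0 A : (0 <= m A)%E.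
Proof. by rewrite lee_fin le_max lexx. Qed.

(** [G n] is the indicator of the union minus those of the first [n] sets. By disjointness it is 1
    on [F k] for [n <= k] and 0 elsewhere, so it tends to 0 pointwise and [L_cvg0] applies. *)
Let m_sigma_additive : semi_sigma_additive m.
Proof.
move=> F mF tF mU.
pose U := \bigcup_k F k; pose G n x : R := \1_U x - \sum_(i < n) \1_(F i) x.
have bFi i : bm \1_(F i) by exact: bm_indic.
have -> : (fun n => \sum_(0 <= i < n) m (F i))%E = (fun n => (L \1_U - L (G n))%:E).
  apply/funext => n; rewrite big_mkord; under eq_bigr do rewrite mE//.
  rewrite sumEFin LB; [|exact: bm_indic|exact: bm_sum].
  by rewrite L_sum// opprB addrC subrK.
rewrite mE//; apply: cvg_EFin; first exact: nearW.
rewrite -[X in _ --> X]subr0; apply: cvgB; first exact: cvg_cst.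
have GE n x k : F k x -> G n x = (n <= k)%:R.
  move=> Fkx; rewrite /G indicE mem_set; last by exists k.
  have Fi i : \1_(F i) x = (i == k)%:R :> R.
    rewrite indicE; congr (nat_of_bool _)%:R; apply/idP/eqP => [|->]; last exact/mem_set.
    by move=> /set_mem Fix; apply: (tF i k) => //; exists x.
  under eq_bigr do rewrite Fi.
  have -> : \sum_(i < n) (nat_of_ord i == k)%:R = (k < n)%N%:R :> R.
    elim: n => [|n ih]; first by rewrite big_ord0.
    rewrite big_ord_recr /= ih ltnS [(k <= n)%N]leq_eqVlt eq_sym.
    by case: (ssrnat.ltngtP k n) => _ /=; rewrite ?addr0 ?add0r.
  by rewrite [(n <= k)%N]leqNgt; case: (k < n)%N => /=; rewrite ?subrr ?subr0.
have GE0 n x : ~ U x -> G n x = 0.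
  move=> Ux; rewrite /G indicE memNset// big1 ?subr0// => i _.
  by rewrite indicE memNset// => Fix; apply: Ux; exists i.
apply: L_cvg0 => [n|n x|x].
- by have [] : bm (G n) by apply: bmB; [exact: bm_indic|exact: bm_sum].
- have [[k _ Fkx]|Ux] := pselect (U x); last by rewrite GE0// lexx ler01.
  by rewrite (GE _ _ _ Fkx) ler0n lern1 leq_b1.
- have [[k _ Fkx]|Ux] := pselect (U x).
    under eq_fun do rewrite (GE _ _ _ Fkx).
    apply: cvg_near_cst; near=> n.
    by apply/eqP; rewrite pnatr_eq0 eqb0 -ltnNge; near: n; exists k.+1.
  by under eq_fun do rewrite GE0//; exact: cvg_cst.
Unshelve. all: by end_near. Qed.

(** [S] is the integer part of [y] capped at [n]. The third clause is what drives the induction. *)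
Let indic_count (y : R) (n : nat) : 0 <= y ->
  let S := \sum_(i < n) ((i.+1%:R : R) <= y)%R%:R : R in
  [/\ S <= y, y <= n%:R -> y - 1 <= S & n%:R <= y -> S = n%:R].
Proof.
move=> y0; elim: n => [|n [ih1 ih2 ih3]].
  by rewrite /= big_ord0; split=> //; lra.
rewrite /= big_ord_recr /= -natr1; have [ny|yn] := leP (n%:R + 1) y.
  by rewrite ih3 ?mulr1n; [split=> *; lra|lra].
by rewrite addr0; split=> //; lra.
Qed.

(** The error [A] is linear, vanishes on constants and indicators, and is at most 1 in absolute
    value on functions with values in the unit interval. Scaling by arbitrarily large [n] then
    forces it to vanish. *)
Lemma daniell_representation : exists mu : probability T R,
  forall f, bm f -> \int[mu]_x f x = L f.
Proof.
have m1 : m setT = 1%E.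
  by rewrite mE// (_ : \1_setT = fun=> 1) ?L1//; apply/funext => x; rewrite indicE in_setT.
pose mm : {measure set T -> \bar R} :=
  HB.pack m (isMeasure.Build d T R m m0 m_ge0 m_sigma_additive).
pose mu : probability T R := probability_of_measure mm m1.
exists mu => f bf; apply/eqP; rewrite -subr_eq0; apply/eqP.
pose A g := \int[mu]_x g x - L g.
have A_lin a g h : bm g -> bm h -> A (fun x => a * g x + h x) = a * A g + A h.
  by move=> bg bh; rewrite /A RintegralT_lin// L_lin//; ring.
have A_cst c : A (fun=> c) = 0.
  rewrite /A RintegralT_cst; have := LZ c (bm_cst 1).
  by under eq_fun do rewrite mulr1; rewrite L1 mulr1 => ->; rewrite subrr.
have A_indic B : measurable B -> A \1_B = 0.
  by move=> mB; rewrite /A RintegralT_indic// (mE mB : mu B = _)/= subrr.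
have A_sum (I : Type) (s : seq I) (F : I -> T -> R) :
    (forall i, bm (F i)) -> (forall i, A (F i) = 0) -> A (fun x => \sum_(i <- s) F i x) = 0.
  move=> bF AF; elim: s => [|i s ih]; first by under eq_fun do rewrite big_nil; exact: A_cst.
  under eq_fun do rewrite big_cons -[X in X + _]mul1r.
  by rewrite A_lin// ?AF ?ih ?mulr0 ?addr0//; exact: bm_sum.
have A_small g : bm g -> (forall x, 0 <= g x <= 1) -> `|A g| <= 1.
  move=> bg g01.
  have Eg0 : 0 <= \int[mu]_x g x.
    by apply: Rintegral_ge0 => x _; have /andP[] := g01 x.
  have Eg1 : \int[mu]_x g x <= 1.
    rewrite -(RintegralT_cst mu 1); apply: RintegralT_le => // [|x]; first exact: bm_cst.
    by have /andP[] := g01 x.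
  have Lg0 : 0 <= L g by apply: L_ge0 => // x; have /andP[] := g01 x.
  have Lg1 : L g <= 1.
    rewrite -L1 -subr_ge0 -LB//; last exact: bm_cst.
    apply: L_ge0 => [|x]; first by apply: bmB => //; exact: bm_cst.
    by rewrite subr_ge0; have /andP[] := g01 x.
  by rewrite ler_norml /A; lra.
(* n g is within 1 of the number of i with i.+1 <= n g, a sum of indicators,
   so n |A g| <= 1 for every n. *)
have A_ge0_eq0 g : bm g -> (forall x, 0 <= g x) -> A g = 0.
  move=> bg g0; have [mg [K gK]] := bg.
  have nA n : n%:R * `|A g| <= 1.
    (* Enough levels for [n%:R * g x] never to exceed [N]. *)
    pose N := (Num.truncn (n%:R * K)).+1.
    pose F i := \1_[set x | i.+1%:R <= n%:R * g x] : T -> R.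
    have mF i : measurable [set x | i.+1%:R <= n%:R * g x].
      rewrite -[X in measurable X]setTI.
      by apply: measurable_fun_le => //; exact: measurable_funM.
    have bF i : bm (F i) by exact: bm_indic.
    pose S x := \sum_(i < N) F i x.
    have bS : bm S by exact: bm_sum.
    have AS : A S = 0 by apply: A_sum => // i; exact: A_indic.
    have An : A (fun x => n%:R * g x - S x) = n%:R * A g.
      have -> : (fun x => n%:R * g x - S x) = (fun x => -1 * S x + (n%:R * g x + 0)).
        by apply/funext => x; ring.
      rewrite A_lin// ?AS ?mulr0 ?add0r; last by apply: bm_lin => //; exact: bm_cst.
      by rewrite A_lin// ?A_cst ?addr0//; exact: bm_cst.
    rewrite -[n%:R in X in X <= _]normr_nat -normrM -An.
    apply: A_small => [|x]; first by apply: bmB => //; exact: bmZ.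
    have ngx0 : 0 <= n%:R * g x by rewrite mulr_ge0.
    have SE : S x = \sum_(i < N) ((i.+1%:R : R) <= n%:R * g x)%R%:R.
      apply: eq_bigr => i _; rewrite /F indicE; congr (nat_of_bool _)%:R.
      by apply/idP/idP; rewrite inE.
    have [S1 S2 _] := indic_count N ngx0.
    rewrite -SE in S1 S2; have {}/S2 : n%:R * g x <= N%:R.
      apply: le_trans (ltW (truncnS_gt _)).
      by rewrite ler_wpM2l// (le_trans (ler_norm _)).
    lra.
  apply/eqP; rewrite -normr_eq0; apply: contrapT => /negP A0.
  have {}A0 : 0 < `|A g| by rewrite lt_neqAle eq_sym A0/=.
  (* An integer above the inverse of the error contradicts [nA]. *)
  have := nA (Num.truncn `|A g|^-1).+1; apply/negP; rewrite -ltNge.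
  by rewrite -ltr_pdivrMr// div1r truncnS_gt.
have [mf [K fK]] := bf.
(* Adding the bound [K] makes [f] nonnegative, and [A] ignores constants. *)
have := A_ge0_eq0 (fun x => 1 * f x + K); rewrite A_lin//; last exact: bm_cst.
rewrite A_cst mul1r addr0; apply; first by apply: bm_lin => //; exact: bm_cst.
by move=> x; have := fK x; rewrite ler_norml; lra.
Qed.
End daniell_representation.

(** * Integrals of convex conjugates *)

Section integral_conjugate.
Local Set Implicit Arguments.
Local Unset Strict Implicit.
Context {d : measure_display} {T : measurableType d} {R : realType}.
Local Notation bm := (@bounded_measurable d T R).
Variable beta : R -> R.
Hypothesis beta_cont : continuous beta.
Hypothesis beta_nd : {homo beta : x y / x <= y}.

Lemma conjugate_ge (x y : R) : ((x * y - beta x)%:E <= conjugate beta y)%E.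
Proof. by apply: ereal_sup_ubound; exists x. Qed.

Lemma conjugate_geN0 (y : R) : ((- beta 0)%:E <= conjugate beta y)%E.
Proof. by have := conjugate_ge 0 y; rewrite mul0r sub0r. Qed.

(** An enumeration of the rationals; an index that decodes to nothing gives 0. *)
Let rational n : R := ratr (odflt 0 (unpickle n)).

(* v n x is the best of 0 and the first n rationals for s * Z x - beta s. *)
Lemma conjugate_approx (Z : T -> R) : measurable_fun setT Z ->
  exists v : nat -> T -> R, [/\ forall n, bm (v n),
    forall x, nondecreasing_seq (fun n => v n x * Z x - beta (v n x)),
    forall n x, - beta 0 <= v n x * Z x - beta (v n x) &
    forall x, (v n x * Z x - beta (v n x))%:E @[n --> \oo] --> conjugate beta (Z x)].
Proof.
move=> mZ; pose phi x s := s * Z x - beta s.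
pose v := fix v n x := if n is n'.+1 then
  if phi x (v n' x) < phi x (rational n') then rational n' else v n' x else 0.
have phi_nd x : nondecreasing_seq (fun n => phi x (v n x)).
  by apply/nondecreasing_seqP => n /=; case: ltP => // /ltW.
have phi_rat x n : phi x (rational n) <= phi x (v n.+1 x) by rewrite /=; case: ltP.
have phi_ge n x : - beta 0 <= phi x (v n x).
  by apply: le_trans (phi_nd x _ _ (leq0n n)); rewrite /phi /= mul0r sub0r.
have mbeta : measurable_fun setT beta by exact: continuous_measurable_fun.
have mphi (w : T -> R) : measurable_fun setT w -> measurable_fun setT (fun x => phi x (w x)).
  move=> mw; apply: measurable_funB; first exact: measurable_funM.
  exact: measurableT_comp mbeta mw.
exists v; split=> // [n|x].
  elim: n => [|n [mv [K vK]]]; first exact: bm_cst.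
  split; first by apply: measurable_fun_ifT => //; apply: measurable_fun_ltr; exact: mphi.
  exists (Num.max K `|rational n|) => x /=; rewrite le_max; case: ifP => _; last by rewrite vK.
  by rewrite lexx orbT.
have -> : conjugate beta (Z x) = ereal_sup (range (fun n => (phi x (v n x))%:E)).
  apply/eqP; rewrite eq_le; apply/andP; split; last first.
    by apply: ge_ereal_sup => _ [n _ <-]; exact: conjugate_ge.
  apply: ge_ereal_sup => _ [s _ <-]; rewrite leNgt; apply/negP.
  set S := ereal_sup _ => Slt.
  have Sge n : ((phi x (v n x))%:E <= S)%E by apply: ereal_sup_ubound; exists n.
  have Sfin : S \is a fin_num.
    by rewrite fin_numElt (lt_le_trans _ (Sge 0%N)) ?ltNyr//= (lt_trans Slt) ?ltry.
  (* If some [s] beat the supremum [S] of the approximants, then by continuity a whole nonempty open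
     set would, and it contains a rational. *)
  have [] := @dense_rat R ([set t | fine S < phi x t]).
  - by exists s; rewrite /= -lte_fin fineK.
  - have cphi : continuous (phi x).
      by move=> t; apply: cvgB; [apply: cvgM => //; exact: cvg_cst|exact: beta_cont].
    exact: (open_comp (fun t _ => cphi t) (@open_gt _ (fine S))).
  - move=> t [/= + [q _ qt]]; rewrite -{t}qt ltNge => /negP; apply.
    have := phi_rat x (pickle q); rewrite /rational pickleK /= => h.
    by rewrite -lee_fin fineK// (le_trans _ (Sge (pickle q).+1))// lee_fin; exact: h.
by apply: ereal_nondecreasing_cvgn => m n mn; rewrite lee_fin; exact: phi_nd.
Qed.

Lemma measurable_conjugate (Z : T -> R) : measurable_fun setT Z ->
  measurable_fun setT (fun x => conjugate beta (Z x)).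
Proof.
move=> mZ; have [v [bv _ _ vE]] := conjugate_approx mZ.
apply: (emeasurable_fun_cvg (fun n x => (v n x * Z x - beta (v n x))%:E)) => // n.
apply/measurable_EFinP/measurable_funB; last by have [] := bm_comp beta_nd (bv n).
by apply: measurable_funM => //; have [] := bv n.
Qed.

Context (theta : probability T R).

(** The negative part is bounded, hence has a finite integral; an infinite integral of the positive
    part would then make the total infinite. *)
Lemma lower_bounded_integrable (c : T -> \bar R) (K : R) : measurable_fun setT c ->
  (forall x, K%:E <= c x)%E -> (\int[theta]_x c x < +oo)%E ->
  theta.-integrable setT c.
Proof.
move=> mc Kc cfin; apply/integrableP; split=> //.
have mcp := measurable_funepos mc; have mcn := measurable_funeneg mc.
have cn_le : (\int[theta]_x c^\- x <= `|K|%:E)%E.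
  have <- : (\int[theta]_x (cst `|K| x)%:E)%E = `|K|%:E.
    by rewrite (EFin_Rintegral theta (bm_cst _)) RintegralT_cst.
  apply: ge0_le_integral => // [|x _]; first exact/measurable_EFinP.
  rewrite funenegE /= ge_max lee_fin normr_ge0 andbT leeNl (le_trans _ (Kc x))//.
  by rewrite -EFinN lee_fin lerNl -normrN ler_norm.
have cpfin : (\int[theta]_x c^\+ x < +oo)%E.
  rewrite ltNge leye_eq; apply/negP => /eqP cp.
  have cn_ge0 : (0 <= \int[theta]_x c^\- x)%E by exact: integral_ge0.
  by move: cfin cn_ge0 cn_le; rewrite integralE cp; case: (\int[theta]_x c^\- x)%E.
rewrite (eq_integral (c^\+ \+ c^\-)%E); last by move=> x _; exact: (congr1 (@^~ x) (fune_abse c)).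
by rewrite ge0_integralD// lte_add_pinfty// (le_lt_trans cn_le)// ltry.
Qed.

(** Exchanges the supremum with the integral: the measurable near-maximizers of [conjugate_approx]
    are admissible choices of [v], and monotone convergence passes to the limit. Adding [beta 0]
    makes the integrands nonnegative. *)
Lemma integral_conjugate_le (Z : T -> R) (M : R) :
  theta.-integrable setT (EFin \o Z) ->
  (forall v, bm v -> \int[theta]_x (v x * Z x - beta (v x)) <= M) ->
  (\int[theta]_x conjugate beta (Z x) <= M%:E)%E.
Proof.
move=> iZ vM; have mZ : measurable_fun setT Z.
  by apply/measurable_EFinP; exact: measurable_int iZ.
have [v [bv v_nd v_ge vE]] := conjugate_approx mZ.
pose phi n x := v n x * Z x - beta (v n x).
have iphi n : theta.-integrable setT (EFin \o phi n).
  have [mv [K vK]] := bv n.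
  have -> : EFin \o phi n = ((EFin \o v n) \* (EFin \o Z) \- (EFin \o (beta \o v n)))%E by [].
  apply: integrableB => //; last exact/bm_integrable/bm_comp.
  apply: integrableMr => //; exists K; split; first exact: num_real.
  by move=> L KL x _; exact: le_trans (vK x) (ltW KL).
have mphi n : measurable_fun setT (phi n) by apply/measurable_EFinP; exact: measurable_int (iphi n).
have mconj := measurable_conjugate mZ.
have mconjD : measurable_fun setT (fun x => conjugate beta (Z x) + (beta 0)%:E)%E.
  exact: emeasurable_funD.
have conjD_ge0 x : (0 <= conjugate beta (Z x) + (beta 0)%:E)%E.
  by rewrite -leeBlDr// sub0e -EFinN conjugate_geN0.
have leD : (\int[theta]_x (conjugate beta (Z x) + (beta 0)%:E) <= (M + beta 0)%:E)%E.
  pose g n x := (phi n x + beta 0)%:E.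
  have mg n : measurable_fun setT (g n).
    by apply/measurable_EFinP; apply: measurable_funD.
  have g_nd x : nondecreasing_seq (g^~ x).
    by move=> m n mn; rewrite lee_fin lerD2r; exact: v_nd.
  have g_ge0 n x : (0 <= g n x)%E by rewrite lee_fin -lerBlDr sub0r; exact: v_ge.
  have gE x : g n x @[n --> \oo] --> (conjugate beta (Z x) + (beta 0)%:E)%E.
    under eq_fun do rewrite /g EFinD.
    apply: cvgeD; [by rewrite fin_num_adde_defl|exact: vE|exact: cvg_cst].
  rewrite (eq_integral (fun x => limn (g^~ x))); last by move=> x _; rewrite (cvg_lim _ (gE x)).
  rewrite monotone_convergence//; apply: lime_le.
    by apply: ereal_nondecreasing_is_cvgn => m n mn; apply: ge0_le_integral => // x _; exact: g_nd.
  apply: nearW => n; rewrite /g.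
  under eq_integral do rewrite EFinD.
  rewrite integralD//; [|exact: (iphi n)|exact: (bm_integrable theta (bm_cst _))].
  rewrite (EFin_Rintegral theta (bm_cst _)) RintegralT_cst EFinD leeD2r//.
  rewrite -[leLHS]fineK ?lee_fin; first exact: vM.
  by apply: integrable_fin_num => //; exact: (iphi n).
have iD : theta.-integrable setT (fun x => conjugate beta (Z x) + (beta 0)%:E)%E.
  exact: (lower_bounded_integrable mconjD conjD_ge0 (le_lt_trans leD (ltry _))).
have -> : (\int[theta]_x conjugate beta (Z x) =
  \int[theta]_x ((conjugate beta (Z x) + (beta 0)%:E) - (beta 0)%:E))%E.
  by apply: eq_integral => x _; rewrite addeK.
rewrite integralB//; last exact: (bm_integrable theta (bm_cst _)).
rewrite (EFin_Rintegral theta (bm_cst _)) RintegralT_cst leeBlDr// -EFinD.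
Qed.
End integral_conjugate.

(** * Duality for the penalized functional *)

Section duality.
Local Set Implicit Arguments.
Local Unset Strict Implicit.
Context {d : measure_display} {T : measurableType d} {R : realType}.
Local Notation bm := (@bounded_measurable d T R).
Implicit Types (mu : probability T R) (f g h : T -> R).
Variables (mu0 theta : probability T R) (H : set (T -> R)) (beta : R -> R) (gamma : R).
Hypothesis H_bm : H `<=` bm.
Hypothesis H_lin : forall (a : R) h1 h2, H h1 -> H h2 -> H (fun x => a * h1 x + h2 x).
Hypothesis H_cst : forall c : R, H (fun=> c).
Hypothesis gamma_gt0 : 0 < gamma.
Hypothesis beta_cont : continuous beta.
Hypothesis beta_nd : {homo beta : x y / x <= y}.
Hypothesis beta_cvx : forall t x y : R, 0 <= t <= 1 ->
  beta (t * x + (1 - t) * y) <= t * beta x + (1 - t) * beta y.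
Local Notation b := (beta_scaled beta gamma).

(** A real-valued version of the density of [mu] with respect to [theta], characterised by bounded
    test functions, the only ones that the duality argument integrates. *)
Definition density mu (Z : T -> R) :=
  theta.-integrable setT (EFin \o Z) /\
  forall u, bm u -> \int[theta]_x (u x * Z x) = \int[mu]_x u x.

Definition agrees_on mu := forall h, H h -> \int[mu]_x h x = \int[mu0]_x h x.

Definition cost g h : R := \int[mu0]_x h x + \int[theta]_x b (g x - h x).

(** Positivity of [gamma] preserves the order both inside and outside [beta]. *)
Lemma beta_scaled_nd : {homo b : x y / x <= y}.
Proof.
move=> x y xy; rewrite /beta_scaled ler_pM2l ?invr_gt0//.
by apply: beta_nd; rewrite ler_pM2l.
Qed.

Lemma beta_scaled_continuous : continuous b.
Proof.
move=> x; apply: cvgM; first exact: cvg_cst.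
by apply: continuous_comp; [apply: cvgM; [exact: cvg_cst|exact: cvg_id]|exact: beta_cont].
Qed.

Lemma beta_scaled_convex (t x y : R) : 0 <= t <= 1 ->
  b (t * x + (1 - t) * y) <= t * b x + (1 - t) * b y.
Proof.
move=> t01; rewrite /beta_scaled mulrCA [X in _ <= _ + X]mulrCA -mulrDr.
rewrite ler_pM2l ?invr_gt0//.
have -> : gamma * (t * x + (1 - t) * y) = t * (gamma * x) + (1 - t) * (gamma * y) by ring.
exact: beta_cvx.
Qed.

Lemma bm_beta_scaled g : bm g -> bm (fun x => b (g x)).
Proof. exact: bm_comp beta_scaled_nd. Qed.

Lemma bm_beta_scaledB g h : bm g -> H h -> bm (fun x => b (g x - h x)).
Proof. by move=> bg /H_bm bh; apply: bm_beta_scaled; exact: bmB. Qed.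

Lemma integrable_bmM u (Z : T -> R) : bm u -> theta.-integrable setT (EFin \o Z) ->
  theta.-integrable setT (EFin \o (fun x => u x * Z x)).
Proof.
move=> [mu' [K uK]] iZ.
have -> : EFin \o (fun x => u x * Z x) = ((EFin \o u) \* (EFin \o Z))%E by [].
apply: integrableMr => //; exists K; split; first exact: num_real.
by move=> L KL x _; exact: le_trans (uK x) (ltW KL).
Qed.

(** Young's inequality at [gamma * (g x - h x)], integrated against [theta]; agreement with [mu0] on
    [H] replaces the integral of [h]. If the conjugate has infinite integral, the left side is minus
    infinity. *)
Lemma weak_duality mu Z g h : agrees_on mu -> density mu Z -> bm g -> H h ->
  ((\int[mu]_x g x)%:E - gamma^-1%:E * \int[theta]_x conjugate beta (Z x)
     <= (cost g h)%:E)%E.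
Proof.
move=> muH [iZ muZ] bg Hh; have bh := H_bm Hh.
have mZ : measurable_fun setT Z by apply/measurable_EFinP; exact: measurable_int iZ.
have [I_lt|] := boolP (\int[theta]_x conjugate beta (Z x) < +oo)%E; last first.
  rewrite -leNgt leye_eq => /eqP ->.
  by rewrite gt0_muley ?lte_fin ?invr_gt0//= leNye.
have mC := measurable_conjugate beta_cont beta_nd mZ.
have iC := lower_bounded_integrable mC (fun x => conjugate_geN0 beta (Z x)) I_lt.
pose u x := gamma * (g x - h x).
have bu : bm u by apply: bmZ; exact: bmB.
have buB : bm (fun x => beta (u x)) by exact: bm_comp.
have iuZ := integrable_bmM bu iZ.
have : (\int[theta]_x ((u x * Z x - beta (u x))%:E) <= \int[theta]_x conjugate beta (Z x))%E.
  apply: le_integral => //.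
    have -> : (fun x => (u x * Z x - beta (u x))%:E) =
      ((EFin \o (fun x => u x * Z x)%R) \- (EFin \o (fun x => beta (u x))))%E by [].
    by apply: integrableB => //; exact: bm_integrable.
  by move=> x _; exact: conjugate_ge.
have -> : (\int[theta]_x ((u x * Z x - beta (u x))%:E))%E =
    (gamma * (\int[mu]_x g x - cost g h))%:E.
  under eq_integral do rewrite EFinB.
  rewrite integralB_EFin//; last exact: bm_integrable.
  rewrite (EFin_Rintegral _ buB).
  rewrite -[X in (X - _)%E]fineK; last exact: integrable_fin_num.
  rewrite -EFinB; congr EFin.
  have -> : fine (\int[theta]_x (u x * Z x)%:E) = \int[mu]_x u x by rewrite -muZ.
  rewrite /u RintegralT_Z; last exact: bmB.
  rewrite RintegralT_B// (muH h Hh) /cost.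
  have -> : \int[theta]_x b (g x - h x) = gamma^-1 * \int[theta]_x beta (u x).
    by rewrite -RintegralT_Z.
  by field; rewrite gt_eqF.
rewrite -[X in (_ <= X)%E]fineK; last exact: integrable_fin_num.
rewrite -[in X in _ -> X](fineK (integrable_fin_num _ iC))// -EFinM -EFinB !lee_fin.
rewrite -ler_pdivlMl//; lra.
Qed.

(** * The primal value function and its subgradient *)

Section primal_finite.
Variables (pi : probability T R) (Zpi : T -> R).
Hypothesis piH : agrees_on pi.
Hypothesis piZ : density pi Zpi.
Hypothesis pi_fin : (\int[theta]_x conjugate beta (Zpi x) < +oo)%E.

Definition psi g : R := inf [set cost g h | h in H].

(** Weak duality against [pi] bounds all costs from below by one real number; this makes the real
    infimum [psi] meaningful. *)
Lemma has_inf_cost g : bm g -> has_inf [set cost g h | h in H].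
Proof.
move=> bg; split; first by exists (cost g (fun=> 0)), (fun=> 0).
have mZ : measurable_fun setT Zpi by apply/measurable_EFinP; exact: measurable_int piZ.1.
have iC := lower_bounded_integrable (measurable_conjugate beta_cont beta_nd mZ)
  (fun x => conjugate_geN0 beta (Zpi x)) pi_fin.
exists (\int[pi]_x g x - gamma^-1 * fine (\int[theta]_x conjugate beta (Zpi x))) => _ [h Hh <-].
have := weak_duality piH piZ bg Hh.
by rewrite -lee_fin EFinB EFinM (fineK (integrable_fin_num _ iC)).
Qed.

Lemma psi_le g h : bm g -> H h -> psi g <= cost g h.
Proof. by move=> bg Hh; apply: ge_inf; [exact: (has_inf_cost bg).2|exists h]. Qed.

Lemma psi_adherent g (e : R) : bm g -> 0 < e -> exists2 h, H h & cost g h < psi g + e.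
Proof.
by move=> bg e0; have [_ [h Hh <-] he] := inf_adherent e0 (has_inf_cost bg); exists h.
Qed.

Lemma cost_mono g1 g2 h : bm g1 -> bm g2 -> H h -> (forall x, g1 x <= g2 x) ->
  cost g1 h <= cost g2 h.
Proof.
move=> b1 b2 Hh g12; rewrite lerD2l; apply: RintegralT_le; try exact: bm_beta_scaledB.
by move=> x; apply: beta_scaled_nd; rewrite lerD2r.
Qed.

(** Hedging [h'] by itself leaves the residual unchanged and adds only its price. The factor 1 is
    the literal form that [H_lin] produces. *)
Lemma cost_shift g h h' : H h -> H h' -> cost (fun x => g x + h' x) (fun x => 1 * h x + h' x) =
  cost g h + \int[mu0]_x h' x.
Proof.
move=> Hh Hh'; rewrite /cost RintegralT_lin ?mul1r; [|exact: H_bm..].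
rewrite addrAC; congr (_ + _ + _); apply: eq_Rintegral => x _; congr b; ring.
Qed.

Lemma cost_convex (t : R) g1 g2 h1 h2 : 0 <= t <= 1 -> bm g1 -> bm g2 -> H h1 -> H h2 ->
  cost (fun x => t * g1 x + (1 - t) * g2 x) (fun x => t * h1 x + (1 - t) * h2 x) <=
  t * cost g1 h1 + (1 - t) * cost g2 h2.
Proof.
move=> t01 b1 b2 Hh1 Hh2; have bh1 := H_bm Hh1; have bh2 := H_bm Hh2.
have bb1 := bm_beta_scaledB b1 Hh1; have bb2 := bm_beta_scaledB b2 Hh2.
rewrite /cost RintegralT_lin//; last exact: bmZ.
rewrite RintegralT_Z// !mulrDr addrACA lerD2l -!RintegralT_Z// -RintegralT_D; [|exact: bmZ..].
apply: RintegralT_le => [||x].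
- by apply: bm_beta_scaled; apply: bmB; apply: bm_lin => //; exact: bmZ.
- by apply: bmD; exact: bmZ.
- rewrite [X in b X](_ : _ = t * (g1 x - h1 x) + (1 - t) * (g2 x - h2 x)); last by ring.
  exact: beta_scaled_convex.
Qed.

Lemma psi_mono g1 g2 : bm g1 -> bm g2 -> (forall x, g1 x <= g2 x) -> psi g1 <= psi g2.
Proof.
move=> b1 b2 g12; apply/ler_addgt0Pr => e e0; have [h Hh /ltW he] := psi_adherent b2 e0.
by rewrite (le_trans (psi_le b1 Hh))// (le_trans _ he)// cost_mono.
Qed.

Lemma psi_shift g h : bm g -> H h -> psi (fun x => g x + h x) <= psi g + \int[mu0]_x h x.
Proof.
move=> bg Hh; apply/ler_addgt0Pr => e e0; have [h' Hh' /ltW he] := psi_adherent bg e0.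
have bgh : bm (fun x => g x + h x) by apply: bmD => //; exact: H_bm.
by rewrite (le_trans (psi_le bgh (H_lin 1 Hh' Hh)))// cost_shift//; lra.
Qed.

(** Partial minimization of the jointly convex [cost], carried out with near-minimizers because the
    infimum need not be attained. *)
Lemma psi_convex (t : R) g1 g2 : 0 <= t <= 1 -> bm g1 -> bm g2 ->
  psi (fun x => t * g1 x + (1 - t) * g2 x) <= t * psi g1 + (1 - t) * psi g2.
Proof.
move=> t01 b1 b2; have /andP[t0 t1] := t01; apply/ler_addgt0Pr => e e0.
have [h1 Hh1 /ltW he1] := psi_adherent b1 e0; have [h2 Hh2 /ltW he2] := psi_adherent b2 e0.
have Hh : H (fun x => t * h1 x + (1 - t) * h2 x).
  apply: H_lin => //; have := H_lin (1 - t) Hh2 (H_cst 0).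
  by under eq_fun do rewrite addr0.
have bg : bm (fun x => t * g1 x + (1 - t) * g2 x) by apply: bm_lin => //; exact: bmZ.
rewrite (le_trans (psi_le bg Hh))// (le_trans (cost_convex t01 b1 b2 Hh1 Hh2))//.
have := ler_wpM2l t0 he1; have t1' : 0 <= 1 - t by rewrite subr_ge0.
have := ler_wpM2l t1' he2; lra.
Qed.

Variables (f : T -> R) (bf : bm f).

(** The increment of [psi] at [f] is convex and vanishes at 0, as [convex_hahn_banach] requires. *)
Lemma exists_subgradient : exists L : (T -> R) -> R,
  (forall (a : R) u v, bm u -> bm v -> L (fun x => a * u x + v x) = a * L u + L v) /\
  (forall v, bm v -> L v <= psi (fun x => f x + v x) - psi f).
Proof.
have := @convex_hahn_banach R (T -> R^o) bm (fun v => psi (fun x => f x + v x) - psi f).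
apply.
- exact: bm_cst.
- by move=> a u v; exact: bm_lin.
- move=> t u v t01 bu bv.
  have := psi_convex t01 (bmD bf bu) (bmD bf bv).
  rewrite (_ : (fun x => _) = (fun x => f x + (t *: u + (1 - t) *: v) x)); first by lra.
  by apply/funext => x; rewrite -[RHS]/(f x + (t * u x + (1 - t) * v x)); ring.
- by rewrite (_ : (fun x => f x + _) = f) ?subrr//; apply/funext => x; exact: addr0.
Qed.

(** A single near-minimizer [h] for [f] serves all directions [g], so that continuity of [L] reduces
    to convergence of integrals against [theta]. *)
Lemma subgradient_le L e h g : (forall v, bm v -> L v <= psi (fun x => f x + v x) - psi f) ->
  H h -> cost f h <= psi f + e -> bm g ->
  L g <= \int[theta]_x (b (f x + g x - h x) - b (f x - h x)) + e.
Proof.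
move=> Lpsi Hh he bg; rewrite (le_trans (Lpsi _ bg))//.
have bfg := bmD bf bg; have := psi_le bfg Hh; move: he.
rewrite RintegralT_B; [|exact: bm_beta_scaledB..]; rewrite /cost; lra.
Qed.

(** The last clause is the dual inequality before the supremum over [v] is taken;
    [integral_conjugate_le] takes it later. *)
Lemma exists_dual : exists mu, [/\ agrees_on mu, mu `<< theta &
  forall v, bm v -> \int[mu]_x v x - \int[theta]_x beta (v x) <=
    gamma * (\int[mu]_x f x - psi f)].
Proof.
have [L [L_lin Lpsi]] := exists_subgradient.
have L0 : L (fun=> 0) = 0.
  have := L_lin (-1) _ _ (bm_cst 0) (bm_cst 0).
  by under eq_fun do rewrite mulr0 addr0; rewrite mulN1r addNr.
have LZ a u : bm u -> L (fun x => a * u x) = a * L u.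
  move=> bu; have := L_lin a _ _ bu (bm_cst 0); rewrite L0 addr0 => <-.
  by under [in RHS]eq_fun do rewrite addr0.
(* Lowering [f] by a nonnegative [u] cannot raise [psi], so [L] is nonpositive at minus [u]. *)
have L_ge0 u : bm u -> (forall x, 0 <= u x) -> 0 <= L u.
  move=> bu u0; have bNu := bmZ (-1) bu.
  have := Lpsi _ bNu; rewrite LZ//.
  have : psi (fun x => f x + -1 * u x) <= psi f.
    by apply: psi_mono => // [|x]; [exact: bmD|rewrite mulN1r gerDl oppr_le0].
  lra.
have LH_le h : H h -> L h <= \int[mu0]_x h x.
  by move=> Hh; have := Lpsi _ (H_bm Hh); have := psi_shift bf Hh; lra.
have LH h : H h -> L h = \int[mu0]_x h x.
  move=> Hh; apply/eqP; rewrite eq_le LH_le//=.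
  have HNh : H (fun x => -1 * h x).
    by have := H_lin (-1) Hh (H_cst 0); under eq_fun do rewrite addr0.
  have := LH_le _ HNh; rewrite LZ ?RintegralT_Z; [|exact: H_bm..]; lra.
have L1 : L (fun=> 1) = 1 by rewrite LH// RintegralT_cst.
have L_cvg0 (F : nat -> T -> R) :
    (forall n, measurable_fun setT (F n)) -> (forall n x, 0 <= F n x <= 1) ->
    (forall x, F n x @[n --> \oo] --> (0 : R)) -> L (F n) @[n --> \oo] --> (0 : R).
  move=> mF F01 F0.
  have bF n : bm (F n).
    split=> //; exists 1 => x; have /andP[F0x F1x] := F01 n x.
    by rewrite ger0_norm.
  (* Half of [e] pays for the near-minimizer, the other half for bounded convergence. *)
  apply/cvgrPdist_le => e e0; have e20 : 0 < e / 2 by rewrite divr_gt0.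
  have [h Hh /ltW he] := psi_adherent bf e20.
  pose G n x := b (f x + F n x - h x) - b (f x - h x).
  have bG n : bm (G n) by apply: bmB; [apply: bm_beta_scaledB => //; exact: bmD|exact: bm_beta_scaledB].
  have [_ [K GK]] : bm (fun x => b (f x + 1 - h x) - b (f x - h x)).
    by apply: bmB; [apply: bm_beta_scaledB => //; apply: bmD => //; exact: bm_cst|exact: bm_beta_scaledB].
  (* Since [F n] lies between 0 and 1, monotonicity puts [G n] between 0 and the increment for the
     constant 1. *)
  have GK' n x : `|G n x| <= K.
    have /andP[F0x F1x] := F01 n x.
    have G0 : 0 <= G n x by rewrite subr_ge0; apply: beta_scaled_nd; rewrite lerD2r lerDl.
    rewrite ger0_norm// (le_trans _ (le_trans (ler_norm _) (GK x)))//.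
    by rewrite lerD2r; apply: beta_scaled_nd; rewrite lerD2r lerD2l.
  have G0 x : G n x @[n --> \oo] --> (fun=> 0) x.
    rewrite -[(fun=> 0) x](subrr (b (f x - h x))); apply: cvgB; last exact: cvg_cst.
    apply: continuous_cvg; first exact: beta_scaled_continuous.
    apply: cvgB; last exact: cvg_cst.
    by rewrite -[X in _ --> X]addr0; apply: cvgD; [exact: cvg_cst|exact: F0].
  have [_] := bounded_convergence theta (fun n => (bG n).1) GK' G0.
  rewrite RintegralT_cst => /cvgrPdist_le /(_ _ e20) Ge.
  near=> n; rewrite sub0r normrN ger0_norm; last first.
    by apply: L_ge0 => // x; have /andP[] := F01 n x.
  have := subgradient_le Lpsi Hh he (bF n).
  have : `|0 - \int[theta]_x G n x| <= e / 2 by near: n.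
  rewrite sub0r normrN => /(le_trans (ler_norm _)); rewrite /G; lra.
have [mu muL] := daniell_representation L_lin L_ge0 L1 L_cvg0.
exists mu; split=> [h Hh||v bv].
- by rewrite muL ?LH//; exact: H_bm.
- apply/null_content_dominatesP => A mA A0.
  have bA : bm \1_A := bm_indic mA.
  suff : L \1_A <= 0.
    rewrite -muL// RintegralT_indic// => muA.
    have : fine (mu A) = 0 by apply/eqP; rewrite eq_le muA fine_ge0.
    by move=> /eqP; rewrite fine_eq0 ?fin_num_measure// => /eqP.
  (* The increment in the direction of the indicator of [A] vanishes off the [theta]-null set [A],
     so its integral contributes nothing. *)
  apply/ler_addgt0Pr => e e0; have [h Hh /ltW he] := psi_adherent bf e0.
  rewrite (le_trans (subgradient_le Lpsi Hh he bA))// lerD2r.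
  set G := fun x => _; have bG : bm G by apply: bmB; [apply: bm_beta_scaledB => //; exact: bmD|exact: bm_beta_scaledB].
  have [_ [K GK]] := bG.
  rewrite (_ : 0 = \int[theta]_x (K * \1_A x)); last first.
    by rewrite RintegralT_Z// RintegralT_indic// A0 mulr0.
  apply: RintegralT_le => // [|x]; first exact: bmZ.
  rewrite [X in _ <= _ * X]indicE; have [xA|xA] := boolP (x \in A).
    by rewrite mulr1; exact: le_trans (ler_norm _) (GK x).
  by rewrite mulr0 /G indicE (negbTE xA) addr0 subrr.
- have bu := bmZ gamma^-1 bv; have bg := bmB bu bf.
  have bufg := bmD bf bg.
  have := Lpsi _ bg; have := psi_le bufg (H_cst 0).
  have -> : (fun x => f x + (gamma^-1 * v x - f x)) = (fun x => gamma^-1 * v x).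
    by apply/funext => x; ring.
  rewrite -!muL// RintegralT_B// RintegralT_Z// /cost RintegralT_cst add0r.
  have -> : \int[theta]_x b (gamma^-1 * v x - 0) = gamma^-1 * \int[theta]_x beta (v x).
    rewrite -RintegralT_Z; last exact: bm_comp.
    by apply: eq_Rintegral => x _; rewrite /beta_scaled subr0 mulrA mulfV ?gt_eqF// mul1r.
  by move=> ? ?; rewrite -ler_pdivrMl// mulrBr; lra.
Unshelve. all: by end_near. Qed.

End primal_finite.
End duality.

(** * Densities from minimizers *)

Section convex_derivative.
Context {R : realType} {b : R -> R}.
Hypothesis b_diff : forall x : R, derivable b x 1.
Hypothesis b_nd : {homo b : x y / x <= y}.
Hypothesis b_cvx : forall t x y : R, 0 <= t <= 1 ->
  b (t * x + (1 - t) * y) <= t * b x + (1 - t) * b y.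

(** A sequential form, ready for bounded convergence. The case [c = 0] is separate because the
    derivative is a limit over punctured neighbourhoods. *)
Lemma cvg_difference_quotient (x c : R) :
  n.+1%:R * (b (x + c / n.+1%:R) - b x) @[n --> \oo] --> c * derive1 b x.
Proof.
have [->|c0] := eqVneq c 0.
  under eq_fun do rewrite mul0r addr0 subrr mulr0.
  by rewrite mul0r; exact: cvg_cst.
have cn : c / n.+1%:R @[n --> \oo] --> (0 : R).
  by rewrite -[X in _ --> X](mulr0 c); apply: cvgM; [exact: cvg_cst|exact: cvg_harmonic].
have cn' : c / n.+1%:R @[n --> \oo] --> 0^'.
  move=> A [e /= e0 eA]; suff : \forall n \near \oo, A (c / n.+1%:R) by [].
  near=> n; apply: eA.
    by near: n; apply: cn; exact: nbhsx_ballx.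
  by rewrite mulf_neq0// invr_eq0 pnatr_eq0.
have D : cvg ((fun h => h^-1 *: ((b \o shift x) (h *: 1) - b x)) @ (0 : R)^') := @b_diff x.
have {D} := cvg_comp _ _ cn' D.
rewrite -[lim _]/('D_1 b x) -derive1E => /(cvgM (cvg_cst c)).
apply: cvg_trans; apply: near_eq_cvg; near=> n => /=.
rewrite /GRing.scale /= mulr1 (addrC _ x); field.
by rewrite c0 nat1r pnatr_eq0.
Unshelve. all: by end_near. Qed.

(** [x + c / n.+1%:R] is the convex combination of [x + c] and [x] with weight [n.+1%:R^-1]. *)
Lemma difference_quotient_le (x c : R) n :
  n.+1%:R * (b (x + c / n.+1%:R) - b x) <= b (x + c) - b x.
Proof.
have n0 : 0 < n.+1%:R :> R by rewrite ltr0n.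
rewrite -ler_pdivlMl// lerBlDr.
have t01 : 0 <= (n.+1%:R^-1 : R) <= 1 by rewrite invr_ge0 ler0n/= invf_le1// ler1n.
have := b_cvx _ (x + c) x t01.
have -> : n.+1%:R^-1 * (x + c) + (1 - n.+1%:R^-1) * x = x + c / n.+1%:R by ring.
by rewrite mulrBl mul1r mulrBr addrAC addrA.
Qed.

Lemma tangent_le (x y : R) : b x + derive1 b x * (y - x) <= b y.
Proof.
rewrite -lerBrDl mulrC -(cvg_lim _ (cvg_difference_quotient x (y - x)))//.
apply: limr_le; first exact: cvgP (cvg_difference_quotient x (y - x)).
by apply: nearW => n; rewrite (le_trans (difference_quotient_le _ _ _))// (addrC x) subrK.
Qed.

Lemma derive1_nd_ge0 (x : R) : 0 <= derive1 b x.
Proof.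
have := tangent_le x (x - 1); have : b (x - 1) <= b x by apply: b_nd; lra.
have -> : x - 1 - x = - 1 by ring.
lra.
Qed.

Lemma derive1_le_increment (x : R) : derive1 b x <= b (x + 1) - b x.
Proof.
have := tangent_le x (x + 1); have -> : x + 1 - x = 1 by ring.
lra.
Qed.

End convex_derivative.

Lemma derivable_beta_scaled {R : realType} (beta : R -> R) (gamma : R) :
  (forall x : R, derivable beta x 1) -> forall x : R, derivable (beta_scaled beta gamma) x 1.
Proof.
move=> beta_diff x.
have Dg : is_derive x 1 (fun y : R => gamma * y) gamma.
  by apply: is_derive_eq; rewrite /GRing.scale /= mulr1.
have Db := DeriveDef (beta_diff (gamma * x)) erefl.
by have [] := is_deriveZ gamma^-1 (is_derive1_comp Db Dg).
Qed.

(** * The first-order condition and the dual measure of a minimizer *)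

Section minimizer.
Local Set Implicit Arguments.
Local Unset Strict Implicit.
Context {d : measure_display} {T : measurableType d} {R : realType}.
Local Notation bm := (@bounded_measurable d T R).
Variables (mu0 theta : probability T R) (H : set (T -> R)) (beta : R -> R) (gamma : R).
Hypothesis H_bm : H `<=` bm.
Hypothesis H_lin : forall (a : R) h1 h2, H h1 -> H h2 -> H (fun x => a * h1 x + h2 x).
Hypothesis H_cst : forall c : R, H (fun=> c).
Hypothesis gamma_gt0 : 0 < gamma.
Hypothesis beta_diff : forall x : R, derivable beta x 1.
Hypothesis beta_nd : {homo beta : x y / x <= y}.
Hypothesis beta_cvx : forall t x y : R, 0 <= t <= 1 ->
  beta (t * x + (1 - t) * y) <= t * beta x + (1 - t) * beta y.
Local Notation b := (beta_scaled beta gamma).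
Variables (f hhat : T -> R).
Hypothesis bf : bm f.
Hypothesis Hhat : H hhat.
Hypothesis hhat_min : forall h, H h ->
  cost mu0 theta beta gamma f hhat <= cost mu0 theta beta gamma f h.

Let b_diff := derivable_beta_scaled beta gamma beta_diff.
Let b_nd := beta_scaled_nd gamma_gt0 beta_nd.
Let b_cvx := beta_scaled_convex gamma_gt0 beta_cvx.
Let u x := f x - hhat x.
Let w x := derive1 b (u x).

Let bu : bm u.
Proof. by apply: bmB => //; exact: H_bm. Qed.

Let bb g : bm g -> bm (fun x => b (g x)).
Proof. exact: bm_comp. Qed.

(** [w] is a pointwise limit of difference quotients, and lies between 0 and the increment of [b]
    over a unit step. *)
Let bw : bm w.
Proof.
split.
  apply: (measurable_fun_cvg (h := fun n x => n.+1%:R * (b (u x + 1 / n.+1%:R) - b (u x)))).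
    move=> n; have [] // : bm (fun x => n.+1%:R * (b (u x + 1 / n.+1%:R) - b (u x))).
    by apply: bmZ; apply: bmB; apply: bb => //; apply: bmD => //; exact: bm_cst.
  by move=> x _; have := cvg_difference_quotient b_diff (u x) 1; rewrite mul1r.
have [_ [K bK]] : bm (fun x => b (u x + 1) - b (u x)).
  by apply: bmB; apply: bb => //; apply: bmD => //; exact: bm_cst.
exists K => x; rewrite ger0_norm; last exact: derive1_nd_ge0.
by rewrite (le_trans (derive1_le_increment b_diff b_cvx _))// (le_trans (ler_norm _) (bK x)).
Qed.

(** Optimality of [hhat] against [hhat] plus [h / n.+1%:R] bounds the integrated difference
    quotients [q n] from below; these converge to the integral of [- h x * w x]. *)
Let first_order_le h : H h -> \int[theta]_x (h x * w x) <= \int[mu0]_x h x.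
Proof.
move=> Hh; have bh := H_bm Hh.
pose q n x := n.+1%:R * (b (u x + - h x / n.+1%:R) - b (u x)).
have bum n : bm (fun x => u x + - h x / n.+1%:R).
  apply: bmD => //; have := bmZ (- n.+1%:R^-1) bh.
  by under eq_fun do rewrite mulNr -mulrN mulrC.
have bq n : bm (q n) by apply: bmZ; apply: bmB; exact: bb.
have bNh : bm (fun x => u x + - h x).
  by apply: bmD => //; have := bmZ (-1) bh; under eq_fun do rewrite mulN1r.
have [_ [K1 bK1]] : bm (fun x => b (u x + - h x) - b (u x)) by apply: bmB; exact: bb.
have [_ [K2 bK2]] : bm (fun x => h x * w x) by exact: bmM.
(* A bound uniform in [n]: from above by convexity, from below by the tangent line. *)
have qK n x : `|q n x| <= K1 + K2.
  have K10 : 0 <= K1 by exact: le_trans (bK1 x).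
  have K20 : 0 <= K2 by exact: le_trans (bK2 x).
  have q_le : q n x <= K1.
    by rewrite (le_trans (difference_quotient_le b_cvx _ _ _))// (le_trans (ler_norm _) (bK1 x)).
  have q_ge : - (h x * w x) <= q n x.
    have := tangent_le b_diff b_cvx (u x) (u x + - h x / n.+1%:R).
    rewrite -/(w x) -lerBrDl addrAC subrr add0r => le1.
    have := ler_wpM2l (ler0n R n.+1) le1.
    by rewrite (_ : _ * (w x * _) = - (h x * w x)); last by field; rewrite nat1r pnatr_eq0.
  have := bK2 x; rewrite !ler_norml => /andP[_ hw2]; lra.
have qE x : q n x @[n --> \oo] --> - h x * w x.
  exact: (cvg_difference_quotient b_diff).
have [_ lim] := bounded_convergence theta (fun n => (bq n).1) qK qE.
have lim_ge : 0 - \int[mu0]_x h x <= \int[theta]_x (- h x * w x).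
  rewrite -(cvg_lim _ lim)//; apply: limr_ge; first exact: cvgP lim.
  apply: nearW => n.
  have n0 : 0 < n.+1%:R :> R by rewrite ltr0n.
  have := hhat_min (H_lin n.+1%:R^-1 Hh Hhat).
  rewrite /cost RintegralT_lin//; last exact: H_bm.
  rewrite [X in _ -> _ <= X]RintegralT_Z; last by apply: bmB; exact: bb.
  rewrite [X in _ -> _ <= _ * X]RintegralT_B; [|exact: bb..].
  have -> : \int[theta]_x b (f x - (n.+1%:R^-1 * h x + hhat x)) =
            \int[theta]_x b (u x + - h x / n.+1%:R).
    by apply: eq_Rintegral => x _; congr b; rewrite /u; ring.
  rewrite sub0r => le1; rewrite -ler_pdivrMl// mulrN; move: le1.
  by move: (n.+1%:R^-1 * _) => A; rewrite /u; lra.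
have : \int[theta]_x (- h x * w x) = - \int[theta]_x (h x * w x).
  rewrite -mulN1r -RintegralT_Z; last exact: bmM.
  by apply: eq_Rintegral => x _; rewrite mulN1r mulNr.
lra.
Qed.

Let first_order h : H h -> \int[theta]_x (h x * w x) = \int[mu0]_x h x.
Proof.
move=> Hh; apply/eqP; rewrite eq_le first_order_le//=.
have HNh : H (fun x => -1 * h x).
  by have := H_lin (-1) Hh (H_cst 0); under eq_fun do rewrite addr0.
have bh := H_bm Hh.
have := first_order_le HNh; under eq_Rintegral do rewrite -mulrA.
by rewrite !RintegralT_Z//; [lra|exact: bmM].
Qed.

(** Counterpart of [exists_dual] with an explicit density: the tangent line of [b] at [u x] makes
    [gamma * u] optimal among all [v]. *)
Lemma minimizer_dual : exists mu : probability T R, [/\ forall A, measurable A ->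
    mu A = (\int[theta]_(x in A) (w x)%:E)%E,
  agrees_on mu0 H mu, mu `<< theta &
  forall v, bm v -> \int[mu]_x v x - \int[theta]_x beta (v x) <=
    gamma * (\int[mu]_x f x - cost mu0 theta beta gamma f hhat)].
Proof.
pose L g := \int[theta]_x (g x * w x).
have w0 x : 0 <= w x by exact: derive1_nd_ge0.
have L_lin (a : R) g1 g2 : bm g1 -> bm g2 -> L (fun x => a * g1 x + g2 x) = a * L g1 + L g2.
  move=> b1 b2; rewrite /L -RintegralT_lin; [|exact: bmM..].
  by apply: eq_Rintegral => x _; ring.
have L_ge0 g : bm g -> (forall x, 0 <= g x) -> 0 <= L g.
  by move=> bg g0; apply: Rintegral_ge0 => x _; rewrite mulr_ge0.
(* Constants lie in [H], so the first-order condition fixes the total mass. *)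
have L1 : L (fun=> 1) = 1 by rewrite /L first_order// RintegralT_cst.
have [mu muL] : exists mu : probability T R, forall g, bm g -> \int[mu]_x g x = L g.
  apply: daniell_representation => // F mF F01 F0.
  have bF n : bm (F n).
    by split=> //; exists 1 => x; have /andP[F0x F1x] := F01 n x; rewrite ger0_norm.
  have [_ [K wK]] := bw.
  have FwK n x : `|F n x * w x| <= K.
    have /andP[F0x F1x] := F01 n x.
    by rewrite normrM (ger0_norm F0x) -[K]mul1r ler_pM.
  have Fw0 x : F n x * w x @[n --> \oo] --> (fun=> 0) x.
    by rewrite -[(fun=> 0) x](mul0r (w x)); apply: cvgM; [exact: F0|exact: cvg_cst].
  have [_] := bounded_convergence theta (fun n => (bmM (bF n) bw).1) FwK Fw0.
  by rewrite RintegralT_cst.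
have muA A : measurable A -> mu A = (\int[theta]_(x in A) (w x)%:E)%E.
  move=> mA; have bA : bm \1_A := bm_indic mA.
  rewrite integral_mkcond.
  have -> : (\int[theta]_x ((fun x => (w x)%:E) \_ A) x = \int[theta]_x (\1_A x * w x)%:E)%E.
    by apply: eq_integral => x _; rewrite epatch_indic /= muleC.
  rewrite EFin_Rintegral; last exact: bmM.
  by rewrite -[RHS]/(L \1_A)%:E -muL// RintegralT_indic// fineK// fin_num_measure.
exists mu; split=> //.
- by move=> h Hh; rewrite muL; [exact: first_order|exact: H_bm].
- apply/null_content_dominatesP => A mA A0; rewrite muA//.
  apply: null_set_integral => //; apply: measurable_int.
  exact: (integrableS measurableT _ _ (bm_integrable theta bw)).
- move=> v bv; have bbu : bm (fun x => b (u x)) by exact: bb.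
  have buw : bm (fun x => u x * w x) by exact: bmM.
  have bbv : bm (fun x => beta (v x)) by exact: bm_comp.
  have bvw : bm (fun x => v x * w x) by exact: bmM.
  (* The first-order condition at [hhat] itself cancels its price, leaving a comparison of
     integrands against [theta]. *)
  have -> : gamma * (\int[mu]_x f x - cost mu0 theta beta gamma f hhat) =
            \int[theta]_x (gamma * (u x * w x - b (u x))).
    rewrite RintegralT_Z ?RintegralT_B//; last exact: bmB.
    rewrite -[X in _ = _ * (X - _)]/(L u) -muL//.
    rewrite [X in _ = _ * (X - _)]RintegralT_B//; last exact: H_bm.
    rewrite [X in _ = _ * (_ - X - _)]muL; last exact: H_bm.
    by rewrite /L first_order// /cost -/u; ring.
  rewrite muL// -RintegralT_B//; apply: RintegralT_le => [||x]; try exact: bmB.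
    by apply: bmZ; exact: bmB.
  rewrite -ler_pdivrMl//.
  have := tangent_le b_diff b_cvx (u x) (v x / gamma).
  rewrite -/(w x) [X in _ <= X -> _]/beta_scaled (mulrCA gamma) mulfV ?gt_eqF// mulr1.
  have -> : gamma^-1 * (v x * w x - beta (v x)) =
      w x * (v x / gamma) - gamma^-1 * beta (v x) by ring.
  rewrite mulrBr; lra.
Qed.

End minimizer.

(** * Borel probability measures *)

Lemma Cb_bounded_measurable (R : realType) (X : ptopologicalType) (f : X -> R) :
  Cb f -> (bounded_measurable : set (borel X -> R)) f.
Proof.
(* [fM] accepts only bounds strictly above [M], hence [M + 1]. *)
move=> [cf [M [_ fM]]]; split; last by exists (M + 1) => x; apply: fM; rewrite ?ltrDl.
apply: (measurability (@RGenOInfty.G R)); first exact: RGenOInfty.measurableE.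
move=> _ [_] [r ->] <-; rewrite setTI; apply: sub_sigma_algebra.
by have /continuousP := cf; apply; exact: interval_open.
Qed.

Lemma convex_function_le (R : realType) (beta : R -> R) :
  convex_function [set: convex_lmodType R^o] beta ->
  forall t x y : R, 0 <= t <= 1 ->
    beta (t * x + (1 - t) * y) <= t * beta x + (1 - t) * beta y.
Proof.
move=> cvx t x y /andP[t0 t1].
exact: (cvx (Itv01 t0 t1) x y (in_setT _) (in_setT _)).
Qed.

(** * Radon-Nikodym derivatives as real densities *)

Section dominated.
Local Set Implicit Arguments.
Local Unset Strict Implicit.
Context {R : realType} {X : ptopologicalType}.
Implicit Types (mu theta : probability (borel X) R).

(** The argument of [c] in [divergence], up to conversion. *)
Definition RN_derivative theta mu (x : borel X) : R :=
  fine (Radon_Nikodym (charge_of_finite_measure mu) theta x).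

Lemma density_Radon_Nikodym theta mu : mu `<< theta -> density theta mu (RN_derivative theta mu).
Proof.
move=> mutheta; have RNE x : (RN_derivative theta mu x)%:E =
    Radon_Nikodym (charge_of_finite_measure mu) theta x.
  by rewrite fineK//; exact: Radon_Nikodym_fin_num.
split=> [|u bu].
  rewrite (_ : _ \o _ = Radon_Nikodym (charge_of_finite_measure mu) theta); last exact/funext.
  exact: Radon_Nikodym_integrable.
have := @Radon_Nikodym_change_of_variables _ _ _ mu theta mutheta (EFin \o u) setT measurableT
  (bm_integrable mu bu).
rewrite /Rintegral => <-; congr fine; apply: eq_integral => x _.
by rewrite EFinM RNE.
Qed.

Lemma divergence_dominated (c : R -> \bar R) theta mu : mu `<< theta ->
  divergence c theta mu = (\int[theta]_x c (RN_derivative theta mu x))%E.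
Proof. by move=> mutheta; rewrite /divergence asboolT. Qed.

Lemma divergence_not_dominated (c : R -> \bar R) theta mu : ~ (mu `<< theta) ->
  divergence c theta mu = +oo%E.
Proof. by move=> mutheta; rewrite /divergence asboolF. Qed.

End dominated.

(** * From real-valued duality to the extended-real functionals *)

Section main.
Local Set Implicit Arguments.
Local Unset Strict Implicit.
Context {R : realType} {X : ptopologicalType}.
Local Notation bm := (@bounded_measurable _ (borel X) R).
Implicit Types (g h : borel X -> R) (mu : probability (borel X) R).
Variables (mu0 theta : probability (borel X) R) (H : set (borel X -> R)).
Variables (beta : R -> R) (gamma : R).
Hypothesis H_bm : H `<=` bm.
Hypothesis H_cst : forall c : R, H (fun=> c).
Hypothesis gamma_gt0 : 0 < gamma.
Hypothesis beta_cont : continuous beta.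
Hypothesis beta_nd : {homo beta : x y / x <= y}.
Local Notation b := (beta_scaled beta gamma).

Lemma marginal_classP mu : marginal_class mu0 H mu <-> agrees_on mu0 H mu.
Proof.
split=> muH h Hh; first by rewrite /Rintegral (muH _ Hh).
by rewrite !EFin_Rintegral ?muH//; exact: H_bm.
Qed.

Lemma penalized_costE g h : bm g -> H h ->
  penalized_cost mu0 theta b g h = (cost mu0 theta beta gamma g h)%:E.
Proof.
move=> bg Hh; rewrite /penalized_cost /cost EFinD !EFin_Rintegral//; last exact: H_bm.
exact: (bm_beta_scaledB H_bm gamma_gt0 beta_nd bg Hh).
Qed.

(** For dominated [mu] this is [weak_duality]; otherwise the penalty is infinite and the objective
    is minus infinity. *)
Lemma dual_objective_le (g h : borel X -> R) mu : marginal_class mu0 H mu -> bm g -> H h ->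
  (dual_objective theta beta gamma g mu <= penalized_cost mu0 theta b g h)%E.
Proof.
move=> /marginal_classP muH bg Hh; rewrite /dual_objective.
have [mutheta|mutheta] := pselect (mu `<< theta).
  rewrite divergence_dominated// EFin_Rintegral// penalized_costE//.
  exact: (weak_duality H_bm gamma_gt0 beta_cont beta_nd muH (density_Radon_Nikodym mutheta)).
rewrite divergence_not_dominated// gt0_muley ?lte_fin ?invr_gt0//.
by rewrite EFin_Rintegral//= leNye.
Qed.

(** The supremum over [v] of the left side of the hypothesis is the divergence, so rearranging gives
    the claim. It serves both the optimal measure of the duality and the one built from a
    minimizer. *)
Lemma dual_objective_ge g mu (c : R) : bm g -> mu `<< theta ->
  (forall v, bm v -> \int[mu]_x v x - \int[theta]_x beta (v x) <=
     gamma * (\int[mu]_x g x - c)) ->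
  (c%:E <= dual_objective theta beta gamma g mu)%E.
Proof.
move=> bg mutheta muv; have [iZ muZ] := density_Radon_Nikodym mutheta.
have : (\int[theta]_x conjugate beta (RN_derivative theta mu x) <=
        (gamma * (\int[mu]_x g x - c))%:E)%E.
  apply: integral_conjugate_le => // v bv.
  rewrite RintegralB//; last 2 first.
  - exact: integrable_bmM.
  - by apply: bm_integrable; exact: bm_comp.
  by rewrite muZ// muv.
rewrite /dual_objective divergence_dominated// EFin_Rintegral//.
have gV0 : (0 < gamma^-1%:E)%E by rewrite lte_fin invr_gt0.
move=> /(lee_wpmul2l (ltW gV0)); rewrite -EFinM mulrA mulVf ?gt_eqF// mul1r.
case: (gamma^-1%:E * _)%E => [r| |]; rewrite ?leey// -?EFinB ?lee_fin//; lra.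
Qed.

Lemma penalized_superhedgingE g : bm g -> has_inf [set cost mu0 theta beta gamma g h | h in H] ->
  penalized_superhedging mu0 H theta b g = (psi mu0 theta H beta gamma g)%:E.
Proof.
move=> bg [ne lb]; rewrite /psi -ereal_inf_EFin//; congr ereal_inf.
rewrite image_comp; apply: eq_imagel => h Hh; exact: penalized_costE.
Qed.

(** A superhedge [h] of [g] has a nonpositive residual [g x - h x], so its penalty is at most that
    of the zero residual, [beta 0 / gamma]. *)
Lemma superhedging_ge g : bm g ->
  (penalized_superhedging mu0 H theta b g - (beta 0 / gamma)%:E <= superhedging mu0 H g)%E.
Proof.
move=> bg; apply: le_ereal_inf_tmp => _ [h [Hh gh] <-]; rewrite leeBlDr//.
apply: le_trans (ereal_inf_lbound _) _; first by exists h.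
rewrite penalized_costE// EFin_Rintegral; last exact: H_bm.
rewrite -EFinD lee_fin lerD2l -(RintegralT_cst theta (beta 0 / gamma)).
apply: RintegralT_le => [||x]; [exact: (bm_beta_scaledB H_bm gamma_gt0 beta_nd bg Hh)|exact: bm_cst|].
rewrite /beta_scaled mulrC ler_pM2r ?invr_gt0//; apply: beta_nd.
by rewrite pmulr_rle0// subr_le0.
Qed.

(** The conjugate is at least [- beta 0]. This excludes the degenerate case when the penalty changes
    sides in [superhedging_le]. *)
Lemma divergence_gtNy mu : (-oo < divergence (conjugate beta) theta mu)%E.
Proof.
have [mutheta|mutheta] := pselect (mu `<< theta); last by rewrite divergence_not_dominated.
have [iZ _] := density_Radon_Nikodym mutheta.
have mZ : measurable_fun setT (RN_derivative theta mu).
  by apply/measurable_EFinP; exact: measurable_int iZ.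
rewrite divergence_dominated//; set D := (X in (_ < X)%E).
have [Dy|] := boolP (D < +oo)%E; last by rewrite -leNgt leye_eq => /eqP ->.
have iC := lower_bounded_integrable (measurable_conjugate beta_cont beta_nd mZ)
  (fun x => conjugate_geN0 beta _) Dy.
by have := integrable_fin_num measurableT iC; rewrite fin_numElt => /andP[].
Qed.

(** Weak duality, infimized over [H], bounds the integral of [g] under [mu]; near-optimality of [mu]
    transfers this to [superhedging] at the price of [eps]. *)
Lemma superhedging_le g (eps : R) mu : bm g ->
  has_inf [set cost mu0 theta beta gamma g h | h in H] -> eps_optimizer mu0 H g eps mu ->
  (superhedging mu0 H g <= penalized_superhedging mu0 H theta b g
    + gamma^-1%:E * divergence (conjugate beta) theta mu + eps%:E)%E.
Proof.
move=> bg inf_cost [muH]; rewrite leeBlDr// => /le_trans; apply; rewrite leeD2r//.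
have obj_le : (dual_objective theta beta gamma g mu <= penalized_superhedging mu0 H theta b g)%E.
  by apply: le_ereal_inf_tmp => _ [h Hh <-]; exact: dual_objective_le.
move: obj_le (divergence_gtNy mu); rewrite /dual_objective EFin_Rintegral//.
rewrite penalized_superhedgingE//; case: (divergence _ _ _) => [r||]//.
  by rewrite -EFinM leeBlDr.
by rewrite gt0_muley ?lte_fin ?invr_gt0// addey// leey.
Qed.

End main.

Local Open Scope ereal_scope.

Theorem theorem2p2 (R : realType) (X : ptopologicalType)
  (polishX : polish R X)
  (mu0 : probability (borel X) R)
  (H : set (X -> R))
  (H_Cb : H `<=` @Cb R X)
  (H_linear : linear_space H)
  (H_cst : forall c : R, H (fun=> c))
  (phi_cont : continuous_from_above (superhedging mu0 H))
  (theta : probability (borel X) R)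
  (gamma : R) (gamma_gt0 : (0 < gamma)%R)
  (beta : R -> R)
  (beta_ge0 : forall x, (0 <= beta x)%R)
  (beta_diff : forall x : R, derivable beta x 1)
  (beta_nondecr : {homo beta : x y / (x <= y)%R})
  (beta_convex : convex_function [set: convex_lmodType R^o] beta)
  (beta_superlinear : (beta x / x)%R @[x --> +oo%R] --> +oo%R)
  (f : X -> R) (f_Cb : Cb f)
  (exists_pi : exists pi : probability (borel X) R,
     [/\ marginal_class mu0 H pi, pi `<< theta
       & divergence (conjugate beta) theta pi < +oo]) :
  let Q := marginal_class mu0 H in
  let phi := superhedging mu0 H in
  let beta_gamma := beta_scaled beta gamma in
  let phi_theta_gamma := penalized_superhedging mu0 H theta beta_gamma in
  [/\ is_max Q (dual_objective theta beta gamma f) (phi_theta_gamma f),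
      forall (eps : R) (mu_eps : probability (borel X) R),
        eps_optimizer mu0 H f eps mu_eps ->
        mu_eps `<< theta ->
        divergence (conjugate beta_gamma) theta mu_eps < +oo ->
        phi_theta_gamma f - (beta 0 / gamma)%:E <= phi f
          <= phi_theta_gamma f
             + gamma^-1%:E * divergence (conjugate beta) theta mu_eps
             + eps%:E
    & forall h_hat : X -> R,
        is_minimizer H (penalized_cost mu0 theta beta_gamma f) h_hat ->
        exists mu_hat : probability (borel X) R,
          (forall A : set (borel X), measurable A ->
             mu_hat A =
             \int[theta]_(x in A) (derive1 beta_gamma (f x - h_hat x)%R)%:E) /\
          is_maximizer Q (dual_objective theta beta gamma f) mu_hat].

Proof.
move=> Q phi beta_gamma phi_theta_gamma.
have H_bm : (H : set (borel X -> R)) `<=` bounded_measurable.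
  by move=> h /H_Cb; exact: Cb_bounded_measurable.
have bf : (bounded_measurable : set (borel X -> R)) f by exact: Cb_bounded_measurable.
have beta_cont : continuous beta.
  by move=> x; apply: differentiable_continuous; apply/derivable1_diffP; exact: beta_diff.
have beta_cvx := convex_function_le _ _ beta_convex.
have H_lin := H_linear.2.
have [pi [piQ pitheta pi_fin]] := exists_pi.
have piH : agrees_on mu0 H pi by apply/marginal_classP.
have piZ := density_Radon_Nikodym pitheta.
rewrite divergence_dominated// in pi_fin.
have inf_cost := has_inf_cost H_bm H_cst gamma_gt0 beta_cont beta_nondecr piH piZ pi_fin bf.
have psiE := penalized_superhedgingE H_bm gamma_gt0 beta_nondecr bf inf_cost.
have obj_le mu : Q mu -> dual_objective theta beta gamma f mu <= phi_theta_gamma f.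
  move=> Qmu; apply: le_ereal_inf_tmp => _ [h Hh <-].
  exact: (dual_objective_le theta H_bm gamma_gt0 beta_cont beta_nondecr Qmu bf Hh).
split.
- have [mu [muH mutheta muv]] := exists_dual H_bm H_lin H_cst gamma_gt0 beta_cont
    beta_nondecr beta_cvx piH piZ pi_fin bf.
  have Qmu : Q mu by apply/marginal_classP.
  split; last exact: obj_le.
  (* Weak duality gives one inequality; the dual inequality with constant [psi] at [f] gives the
     other. *)
  exists mu => //; apply/eqP; rewrite eq_le obj_le//= /phi_theta_gamma psiE.
  exact: (dual_objective_ge gamma_gt0 beta_cont beta_nondecr bf mutheta muv).
- move=> eps mu_eps mu_opt _ _; apply/andP; split.
    exact: (superhedging_ge mu0 theta H_bm gamma_gt0 beta_nondecr bf).
  exact: (superhedging_le H_bm gamma_gt0 beta_cont beta_nondecr bf inf_cost mu_opt).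
- move=> h_hat [Hhat hat_min].
  have costE := penalized_costE mu0 theta H_bm gamma_gt0 beta_nondecr bf.
  have hat_min' h : H h -> (cost mu0 theta beta gamma f h_hat <= cost mu0 theta beta gamma f h)%R.
    by move=> Hh; rewrite -lee_fin -!costE//; exact: hat_min.
  have [mu [muE muH mutheta muv]] := minimizer_dual H_bm H_lin H_cst gamma_gt0 beta_diff
    beta_nondecr beta_cvx bf Hhat hat_min'.
  exists mu; split; first exact: muE.
  (* The objective at [mu] is at least the cost of [h_hat], hence at least the primal infimum, which
     dominates the objective on all of [Q]. *)
  split=> [|nu /obj_le/le_trans]; first by apply/marginal_classP.
  apply; apply: le_trans (dual_objective_ge gamma_gt0 beta_cont beta_nondecr bf mutheta muv).
  by rewrite -costE//; apply: ereal_inf_lbound; exists h_hat.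
Qed.
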